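(* Assume $q\equiv 3\pmod 4$ and let $\rho_\psi=\mathrm{Ind}_{F^\times\mathrm{Sp}(W)}^{\mathrm{GSp}(W)}\pi_\psi$. Then for any $a\in F^\times\setminus F^{\times2}$, $\mathrm{Res}_{\mathrm{Sp}(W)}^{\mathrm{GSp}(W)}\rho_\psi\simeq\pi_\psi\oplus\pi_{\psi^a}$.
   Context: $F=\mathbb F_q$ is a finite field of odd cardinality; $(W,\langle,\rangle)$ is a symplectic $F$-space of dimension $2m$ with complete polarization $W=X\oplus X^*$, symplectic basis $e_i\in X$, $e_i^*\in X^*$; groups act on $W$ on the right. $\mathrm{GSp}(W)$ is the similitude group, $\lambda:g\mapsto\lambda_g$ the similitude factor, $F^\times\mathrm{Sp}(W)=\{tg: t\in F^\times, g\in\mathrm{Sp}(W)\}=\{h\in\mathrm{GSp}(W):\lambda_h\in F^{\times2}\}$. $\psi$ is a non-trivial character of $F$ and $\psi^a(t)=\psi(at)$. The Weil representation $\pi_\psi$ of $\mathrm{Sp}(W)$ is realized on $\mathbb C[X]$ (functions on $X$) by: $\pi_\psi\begin{pmatrix}1&b\\0&1\end{pmatrix}f(y)=\psi(\tfrac12\langle y,yb\rangle)f(y)$; $\pi_\psi\begin{pmatrix}a&0\\0&a^{*-1}\end{pmatrix}f(y)=\chi_q^+(\det a)f(ya)$; $\pi_\psi(\omega)f(y)=\gamma(\psi)^{-m}\sum_{x\in X}f(x)\psi(\langle x,y\omega\rangle)$; here $b\in\mathrm{Hom}(X,X^* )$ is symmetric, $a\in\mathrm{Aut}(X)$ with adjoint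 $a^*$, $e_i\omega=-e_i^*$, $e_i^*\omega=e_i$, $\gamma(\psi)=\sum_{x\in F}\psi(x^2/2)$, $\chi_q^+$ the Legendre symbol. For $q\equiv3\pmod4$, $F^{\times2}$ has odd order; let $\varpi$ be a fixed generator of $F^{\times2}$ and $\tau:F^{\times2}\to F^\times$ the homomorphism $\varpi^2\mapsto\varpi^{-1}$. The representation $\pi_\psi$ is extended to $F^\times\mathrm{Sp}(W)$ by letting scalars $a\in F^\times$ act by $\pi_\psi\begin{pmatrix}a&0\\0&a\end{pmatrix}f(y)=\chi_q^+(a^m)f(\tau(a^2)ya)$. *)

(* Defs.v *)
From HB Require Import structures.
From mathcomp Require Import all_boot all_order all_algebra all_fingroup.
From mathcomp Require Import all_solvable all_field all_character.

Set Implicit Arguments.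
Unset Strict Implicit.
Unset Printing Implicit Defensive.

Import GroupScope Order.TTheory GRing.Theory Num.Theory.
Local Open Scope ring_scope.

Section SymplecticSpace.

Variables (F : finFieldType) (m : nat).
Local Notation X := 'rV[F]_m.
Local Notation W := 'rV[F]_(m + m).

(* W is the space of row vectors of length 2m, on which matrices act on the   *)
(* right; e_i (resp. e_i^* ) is the i-th basis vector of the first (resp.     *)
(* second) block. X and X^* are identified with F^m through these bases, by   *)
(* inX and inXs. The form is given by <e_i, e_j^*> = delta_ij.                *)
Definition inX (y : X) : W := row_mx y 0.
Definition inXs (z : X) : W := row_mx 0 z.

Definition form_mx : 'M[F]_(m + m) := block_mx 0 1%:M (- 1%:M) 0.

Definition form (w w' : W) : F := (w *m form_mx *m w'^T) 0 0.

Definition similitude (l : F) (g : 'M[F]_(m + m)) : bool :=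
  [forall w, forall w', form (w *m g) (w' *m g) == l * form w w'].

(* Matrices, in the basis (e_i, e_i^* ), of the standard elements of Sp(W).   *)
Definition nX_mx (b : 'M[F]_m) : 'M[F]_(m + m) := block_mx 1%:M b 0 1%:M.
Definition mX_mx (a : 'M[F]_m) : 'M[F]_(m + m) :=
  block_mx a 0 0 (invmx a^T).
Definition omega_mx : 'M[F]_(m + m) := block_mx 0 (- 1%:M) 1%:M 0.

Lemma formE (y z y' z' : X) :
  form (row_mx y z) (row_mx y' z') = (y *m z'^T) 0 0 - (z *m y'^T) 0 0.
Proof.
rewrite /form /form_mx mul_row_block !mulmx0 add0r addr0 mulmx1 mulmxN mulmx1.
by rewrite tr_row_mx mul_row_col mulNmx addrC !mxE.
Qed.

Lemma similitudeP l g :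
  reflect (forall w w', form (w *m g) (w' *m g) = l * form w w')
          (similitude l g).
Proof.
apply: (iffP forallP) => [sim w w' | sim w]; last first.
  by apply/forallP => w'; apply/eqP/sim.
by apply/eqP; move/forallP: (sim w); apply.
Qed.

Lemma similitude_mx l g :
  similitude l g = (g *m form_mx *m g^T == l *: form_mx).
Proof.
apply/similitudeP/eqP => [sim | eq_g w w']; last first.
  have -> : form (w *m g) (w' *m g) =
      (w *m (g *m form_mx *m g^T) *m w'^T) 0 0.
    by rewrite /form trmx_mul !mulmxA.
  by rewrite eq_g -scalemxAr -scalemxAl mxE.
apply/matrixP => i j; pose u : W := delta_mx 0 i; pose v : W := delta_mx 0 j.
have entry (A : 'M_(m + m)) : (u *m A *m v^T) 0 0 = A i j.
  by rewrite trmx_delta -rowE -colE !mxE.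
rewrite -[LHS]entry -[RHS]entry -scalemxAr -scalemxAl [RHS]mxE.
by rewrite -[RHS]/(l * form u v) -sim /form trmx_mul !mulmxA.
Qed.

Lemma similitude1 : similitude 1 1%:M.
Proof. by apply/similitudeP => w w'; rewrite !mulmx1 mul1r. Qed.

Lemma similitudeM l l' g g' :
  similitude l g -> similitude l' g' -> similitude (l * l') (g *m g').
Proof.
move=> /similitudeP sg /similitudeP sg'; apply/similitudeP => w w'.
by rewrite !mulmxA sg' sg mulrCA mulrA.
Qed.

Lemma similitudeZ t g : similitude 1 g -> similitude (t ^+ 2) (t *: g).
Proof.
move=> /similitudeP sg; apply/similitudeP => w w'.
rewrite -!scalemxAr /form linearZ /= -!scalemxAl -scalemxAr scalerA mxE.
by rewrite -[X in _ * X]/(form (w *m g) (w' *m g)) sg mul1r.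
Qed.

Lemma form_mx_unit : form_mx \in unitmx.
Proof.
apply: (@mulmx1_unit _ _ _ (- form_mx) _).1.
rewrite mulmxN /form_mx mulmx_block !mul0mx !mulmx0 !mul1mx !add0r !addr0.
by rewrite mulmx1 opp_block_mx !oppr0 !opprK -scalar_mx_block.
Qed.

Lemma similitude_unit l g : l != 0 -> similitude l g -> g \in unitmx.
Proof.
move=> l0; rewrite similitude_mx => /eqP eq_g.
have: l *: form_mx \in unitmx by rewrite unitmxZ ?form_mx_unit ?unitfE.
by rewrite -eq_g !unitmx_mul => /andP[/andP[]].
Qed.

Lemma similitude_nX b : b^T = b -> similitude 1 (nX_mx b).
Proof.
move=> sym_b; apply/similitudeP => w w'; rewrite mul1r.
rewrite -(hsubmxK w) -(hsubmxK w') !mul_row_block !mulmx0 !mulmx1 !addr0 !formE.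
rewrite !linearD /= mulmxDl trmx_mul sym_b mulmxA.
by rewrite [X in X - _]mxE [X in _ - X]mxE opprD addrACA subrr add0r.
Qed.

Lemma similitude_mX a : a \in unitmx -> similitude 1 (mX_mx a).
Proof.
move=> ua; apply/similitudeP => w w'; rewrite mul1r.
rewrite -(hsubmxK w) -(hsubmxK w') !mul_row_block !mulmx0 !addr0 !add0r !formE.
rewrite !trmx_mul trmx_inv trmxK !mulmxA mulmxK //.
by rewrite mulmxKV ?unitmx_tr.
Qed.

Lemma similitude_omega : similitude 1 omega_mx.
Proof.
apply/similitudeP => w w'; rewrite mul1r -(hsubmxK w) -(hsubmxK w').
rewrite !mul_row_block !mulmx0 !mulmxN !mulmx1 !addr0 !add0r !formE.
rewrite !linearN /= mulNmx.
by rewrite [X in X - _]mxE [X in _ - X]mxE opprK addrC.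
Qed.

End SymplecticSpace.

Section Groups.

(* dim W = 2 (n + 1), as {'GL_d[F]} needs a successor dimension.              *)
Variables (F : finFieldType) (n : nat).
Local Notation gT := {'GL_(n.+1 + n.+1)[F]}.

Definition gmx (g : gT) : 'M[F]_(n.+1 + n.+1) := GLval g.

Lemma gmx1 : gmx 1%g = 1%:M. Proof. by []. Qed.
Lemma gmxM g h : gmx (g * h)%g = gmx g *m gmx h. Proof. by []. Qed.

Lemma gmx_inj : injective gmx. Proof. exact: val_inj. Qed.

Lemma exists_gmx A : A \in unitmx -> exists g, gmx g = A.
Proof. by move=> uA; exists (FinRing.unit _ uA). Qed.

Definition Sp_set : {set gT} := [set g | similitude 1 (gmx g)].

Definition GSp_set : {set gT} :=
  [set g | [exists l : F, (l != 0) && similitude l (gmx g)]].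

(* The group F^* Sp(W). *)
Definition FSp_set : {set gT} :=
  [set g | [exists t : {unit F},
     [exists h in Sp_set, gmx g == val t *: gmx h]]].

Lemma Sp_group_set : group_set Sp_set.
Proof.
apply/group_setP; split=> [|g h]; first by rewrite inE gmx1 similitude1.
rewrite !inE => sg sh; rewrite -[1]mulr1; exact: similitudeM.
Qed.
Canonical Sp := Group Sp_group_set.

Lemma GSp_group_set : group_set GSp_set.
Proof.
apply/group_setP; split=> [|g h].
  by rewrite inE; apply/existsP; exists 1; rewrite oner_neq0 gmx1 similitude1.
rewrite !inE => /existsP[l /andP[l0 sg]] /existsP[k /andP[k0 sh]].
by apply/existsP; exists (l * k); rewrite mulf_neq0 //=; exact: similitudeM.
Qed.
Canonical GSp := Group GSp_group_set.

Lemma FSp_group_set : group_set FSp_set.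
Proof.
apply/group_setP; split=> [|g h].
  rewrite inE; apply/existsP; exists 1%g; apply/existsP; exists 1%g.
  by rewrite group1 /= scale1r.
rewrite !inE => /existsP[t /existsP[g' /andP[Sg /eqP eq_g]]].
case/existsP=> [s /existsP[h' /andP[Sh /eqP eq_h]]].
apply/existsP; exists (t * s)%g; apply/existsP; exists (g' * h')%g.
apply/andP; split; first exact: (groupM Sg Sh).
apply/eqP; transitivity (gmx g *m gmx h) => //.
by rewrite eq_g eq_h -scalemxAl -scalemxAr scalerA.
Qed.
Canonical FSp := Group FSp_group_set.

Lemma Sp_sub_FSp : Sp \subset FSp.
Proof.
apply/subsetP => g Sg; rewrite inE; apply/existsP; exists 1%g.
by apply/existsP; exists g; rewrite Sg /= scale1r.
Qed.

Lemma FSp_sub_GSp : FSp \subset GSp.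
Proof.
apply/subsetP => g; rewrite !inE => /existsP[t /existsP[h /andP[Sh /eqP ->]]].
apply/existsP; exists (val t ^+ 2); rewrite inE in Sh.
by rewrite expf_neq0 -?unitfE ?similitudeZ // (valP t).
Qed.

Lemma Sp_sub_GSp : Sp \subset GSp.
Proof. exact: subset_trans Sp_sub_FSp FSp_sub_GSp. Qed.

Lemma exists_Sp A : similitude 1 A -> exists2 g, g \in Sp & gmx g = A.
Proof.
move=> sA; have [|g eq_g] := @exists_gmx A.
  by apply: similitude_unit sA; apply: oner_neq0.
by exists g; rewrite // inE eq_g.
Qed.

End Groups.

Section InducedRepresentation.

Variables (C : fieldType) (gT : finGroupType) (G H : {group gT}).
Variables (sHG : H \subset G) (d : nat) (rH : mx_representation C H d).

(* The representation of G by right translations on the functions             *)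
(* phi : G -> C^d with phi (h g) = rH h (phi g) for h in H, written in the    *)
(* coordinates phi |-> (phi (t_i))_i, where (t_i) represents H \ G.           *)
Definition coset_rep (i : 'I_#|G : H|) : gT := repr (enum_val i).

Definition ind_mx (g : gT) :=
  \mxblock_(i < #|G : H|, j < #|G : H|)
    let h := (coset_rep i * g * (coset_rep j)^-1)%g in
    if h \in H then rH h else 0.

Lemma coset_rep_in i : coset_rep i \in G.
Proof.
rewrite /coset_rep; have /rcosetsP[x Gx ->] := enum_valP i.
by case: repr_rcosetP => h Hh; rewrite groupM // (subsetP sHG).
Qed.

Lemma coset_rep_rcoset i : H :* coset_rep i = enum_val i.
Proof.
by rewrite /coset_rep; have /rcosetsP[x Gx ->] := enum_valP i; rewrite rcoset_repr.
Qed.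

Lemma exists_coset_rep x : x \in G -> exists i, (x * (coset_rep i)^-1)%g \in H.
Proof.
move=> Gx; have HxG : H :* x \in rcosets H G by apply/rcosetsP; exists x.
exists (enum_rank_in HxG (H :* x)).
by rewrite -mem_rcoset coset_rep_rcoset enum_rankK_in // rcoset_refl.
Qed.

Lemma coset_rep_uniq x i j :
  (x * (coset_rep i)^-1)%g \in H -> (x * (coset_rep j)^-1)%g \in H -> i = j.
Proof.
rewrite -!mem_rcoset => /rcoset_eqP eq_i /rcoset_eqP eq_j.
by apply: enum_val_inj; rewrite -!coset_rep_rcoset -eq_i -eq_j.
Qed.

Lemma ind_mx_repr : mx_repr G ind_mx.
Proof.
split=> [|g h Gg Gh].
  rewrite -mxdiagZ; apply: eq_mxblock => i j /=; rewrite mulg1.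
  case: (eqVneq i j) => [<-|neq_ij].
    by rewrite mulgV group1 repr_mx1 conform_mx_id.
  case: ifP => // Hij; case/eqP: neq_ij.
  by apply: (@coset_rep_uniq (coset_rep i)) => //; rewrite mulgV group1.
rewrite mul_mxblock; apply: eq_mxblock => i k /=.
have [j Hj] := exists_coset_rep (groupM (coset_rep_in i) Gg).
rewrite (bigD1 j) //= Hj big1 ?addr0 => [|j' neq_j]; last first.
  case: ifP => [Hj'|_]; last by rewrite mul0mx.
  by rewrite (coset_rep_uniq Hj' Hj) eqxx in neq_j.
have -> : (coset_rep i * (g * h) * (coset_rep k)^-1 =
  (coset_rep i * g * (coset_rep j)^-1) * (coset_rep j * h * (coset_rep k)^-1))%g.
  by rewrite !mulgA mulgKV.
rewrite groupMl //; case: ifP => Hk; last by rewrite mulmx0.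
by rewrite repr_mxM.
Qed.

Definition ind_repr := MxRepresentation ind_mx_repr.

End InducedRepresentation.

(* The character of the induced representation is the library's induced       *)
(* class function.                                                            *)
Lemma cfRepr_ind (gT : finGroupType) (G H : {group gT}) (sHG : H \subset G)
    (d : nat) (rH : mx_representation algC H d) :
  cfRepr (ind_repr sHG rH) = 'Ind[G] (cfRepr rH).
Proof.
apply/cfun_inP => x Gx; rewrite cfunE Gx mulr1n cfIndE // mxtrace_mxblock.
apply: (canRL (mulKf (neq0CG H))); rewrite mulr_sumr.
have -> : \sum_(y in G) cfRepr rH (x ^ y)%g =
    \sum_(y in G) cfRepr rH (y * x * y^-1)%g.
  rewrite (reindex_inj invg_inj); apply: eq_big => [y|y _]; first exact: groupV.
  by rewrite conjgE invgK mulgA.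
rewrite (set_partition_big _ (rcosets_partition sHG)) big_enum_val /=.
apply: eq_bigr => i _; rewrite -coset_rep_rcoset.
set t := coset_rep i.
rewrite (eq_bigr (fun=> cfRepr rH (t * x * t^-1)%g)) => [|y].
  rewrite sumr_const card_rcoset mulr_natl; congr (_ *+ _).
  by rewrite cfunE; case: ifP => // _; rewrite ?mulr1n // mxtrace0 mulr0n.
case/rcosetP => h Hh ->; rewrite -(cfunJ _ (t * x * t^-1)%g (groupVr Hh)).
by rewrite conjgE invgK invMg !mulgA.
Qed.

Section Weil.

Variables (C : numClosedFieldType) (F : finFieldType).

Definition nontrivial_character (psi : F -> C) : Prop :=
  [/\ psi 0 = 1, {morph psi : x y / x + y >-> x * y}
    & exists x, psi x != 1].

Definition twist (psi : F -> C) (a : F) : F -> C := fun t => psi (a * t).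

Definition legendre (x : F) : C :=
  if x == 0 then 0 else if [exists t : F, x == t ^+ 2] then 1 else - 1.

Definition gamma (psi : F -> C) : C := \sum_(x : F) psi (x ^+ 2 / 2%:R).

Definition squares : {set {unit F}} := [set (t ^+ 2)%g | t : {unit F}].

Lemma squares_group_set : group_set squares.
Proof.
apply/group_setP; split=> [|_ _ /imsetP[s _ ->] /imsetP[t _ ->]].
  by apply/imsetP; exists 1%g; rewrite ?expg1n.
apply/imsetP; exists (s * t)%g; rewrite // expgMn //.
by apply: val_inj; rewrite /= mulrC.
Qed.
Canonical squares_group := Group squares_group_set.

Variable n : nat.
Local Notation X := 'rV[F]_n.+1.

(* C[X] is identified with C^|X|, and the endomorphisms of C[X] with the      *)
(* matrices acting on columns, so that operators compose as matrices multiply. *)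
Definition fun_col (f : X -> C) : 'cV[C]_#|{: X}| :=
  \col_i f (enum_val i).

(* Sp(W) is generated by the elements below, so that at most one pi satisfies *)
(* weil_repr psi.                                                             *)
Definition weil_repr (psi : F -> C)
    (pi : mx_representation C (Sp F n) #|{: X}|) : Prop :=
  [/\ forall (b : 'M[F]_n.+1) g, b^T = b -> gmx g = nX_mx b ->
        forall f, pi g *m fun_col f =
          fun_col (fun y =>
            psi (2%:R^-1 * form (inX y) (inXs (y *m b))) * f y),
      forall (a : 'M[F]_n.+1) g, a \in unitmx -> gmx g = mX_mx a ->
        forall f, pi g *m fun_col f =
          fun_col (fun y => legendre (\det a) * f (y *m a))
    & forall g, gmx g = omega_mx F n.+1 ->
        forall f, pi g *m fun_col f =
          fun_col (fun y => gamma psi ^- n.+1 *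
            \sum_(x : X) f x * psi (form (inX x) (inX y *m omega_mx F n.+1)))].

Definition weil_extension (tau : {unit F} -> {unit F})
    (pi : mx_representation C (Sp F n) #|{: X}|)
    (piE : mx_representation C (FSp F n) #|{: X}|) : Prop :=
  (forall g, g \in Sp F n -> piE g = pi g) /\
  (forall (t : {unit F}) g, gmx g = (val t)%:M ->
     forall f, piE g *m fun_col f =
       fun_col (fun y => legendre (val t ^+ n.+1) *
         f (val (tau (t ^+ 2)%g) *: (val t *: y)))).

End Weil.

(* Main.v *)
Require Import Defs.
From HB Require Import structures.
From mathcomp Require Import all_boot all_order all_algebra all_fingroup.
From mathcomp Require Import all_solvable all_field all_character.

Set Implicit Arguments.
Unset Strict Implicit.
Unset Printing Implicit Defensive.

Import GroupScope Order.TTheory GRing.Theory Num.Theory.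
Local Open Scope ring_scope.

(** Write d for the similitude diag(a, 1), of factor a. Since a is not a
    square, d lies outside F^* Sp(W), and F^* Sp(W) has index two in GSp(W):
    the similitude factor embeds the quotient in F^* / F^{*2}, a group of order
    two. Mackey's formula for the normal subgroup Sp(W) (res_ind_index2) then
    splits the restriction of rho_psi as the sum of pi_psi and of its conjugate
    g |-> pi_psi (d g d^-1), and what is left is that this conjugate is
    pi_{psi^a}, not only up to isomorphism but as operators on C[X]
    (weil_repr_twist).

    Both sides being representations, they need only be compared on a set of
    generators of Sp(W). Conjugation by d sends n(b) to n(a b), fixes m(A), and
    sends omega to m(a) omega. On the first two kinds the formulas agree at
    sight. On omega, m(a) contributes the sign legendre (a ^ m) = (-1) ^ m, and
    this is what replaces gamma(psi) ^- m by gamma(psi^a) ^- m, because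
    gamma(psi^a) = - gamma(psi) for a non-square a (gamma_twist).

    That the n(b), the m(A) and omega generate Sp(W) (Sp_subset) goes through
    the open cell: when the block A of g is invertible, g is a product of a
    lower unipotent, an m(A) and an n(b); and any g is brought to this case by
    right multiplication by a suitable lower unipotent (exists_sym_unit). *)

(** * Restriction of a representation induced from index two *)

Section IndexTwo.

Variables (C : fieldType) (gT : finGroupType) (G H N : {group gT}) (d : nat).
Variables (sHG : H \subset G) (sNG : N \subset G) (sNH : N \subset H).
Hypothesis iH2 : #|G : H| = 2%N.

Lemma index2_divg x y : x \in G :\: H -> y \in G :\: H -> (x * y^-1)%g \in H.
Proof. by move=> GHx GHy; rewrite -mem_rcoset (rcoset_index2 sHG). Qed.

(** Each coset representative t is h or h s with h in H, and the corresponding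
    block g |-> rH (t g t^-1) is conjugate under rH h to rN or to rN'; the
    intertwiner stacks these operators rH h, in the left or right half. *)
Lemma res_ind_index2 (rH : mx_representation C H d)
    (rN rN' : mx_representation C N d) s :
    G \subset 'N(N) -> s \in G :\: H -> {in N, forall g, rN g = rH g} ->
    {in N, forall g, rN' g = rH (s * g * s^-1)%g} ->
  mx_rsim (subg_repr (ind_repr sHG rH) sNG)
          (dadd_grepr (Representation rN) (Representation rN')).
Proof.
move=> nNG GHs rNE rN'E; have [/setDP[Gs notHs]] := (GHs).
pose t := @coset_rep gT G H.
have Gt i : t i \in G by apply: coset_rep_in.
have NJ g x : g \in N -> x \in G -> (x * g * x^-1)%g \in N.
  move=> Ng Gx; have := memJ_norm g (subsetP nNG _ (groupVr Gx)).
  by rewrite conjgE invgK mulgA Ng.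
have GHt i : t i \notin H -> t i \in G :\: H by move=> nHt; rewrite !inE nHt Gt.
have Hts i : t i \notin H -> (t i * s^-1)%g \in H.
  by move/GHt=> nHt; apply: index2_divg.
pose L i : 'M[C]_(d, d + d) :=
  if t i \in H then row_mx (rH (t i)) 0 else row_mx 0 (rH (t i * s^-1)%g).
pose R i : 'M[C]_(d + d, d) :=
  if t i \in H then col_mx (rH (t i)^-1%g) 0
  else col_mx 0 (rH (t i * s^-1)^-1%g).
apply: (@MxReprSim _ _ _ _ _ _ _ (\mxcol_i L i)) => [||g Ng].
- by rewrite sum_nat_const card_ord iH2 mul2n addnn.
- apply/row_freeP; exists (\mxrow_j R j).
  rewrite mul_mxcol_mxrow -mxdiagZ; apply: eq_mxblock => i j /=.
  case: (eqVneq i j) => [<-|neq_ij].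
    rewrite conform_mx_id /L /R; case: ifP => Hi.
      by rewrite mul_row_col mulmx0 addr0 -repr_mxM ?groupV // mulgV repr_mx1.
    have Hi' := Hts _ (negbT Hi).
    by rewrite mul_row_col mulmx0 add0r -repr_mxM ?groupV // mulgV repr_mx1.
  have notH2: (t i * (t j)^-1)%g \notin H.
    apply: contra neq_ij => Hij; apply/eqP.
    by apply: (coset_rep_uniq (x := t i)); rewrite ?mulgV.
  rewrite /L /R; case: ifP => Hi; case: ifP => Hj.
  + by rewrite groupM ?groupV in notH2.
  + by rewrite mul_row_col mulmx0 mul0mx addr0.
  + by rewrite mul_row_col mulmx0 mul0mx addr0.
  + by rewrite index2_divg ?GHt ?Hi ?Hj in notH2.
- rewrite /= mul_mxblock_mxrow mxcol_mul; apply: eq_mxcol => i.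
  have Hii := subsetP sNH _ (NJ _ _ Ng (Gt i)).
  rewrite (bigD1 i) //= big1 ?addr0 => [|j neq_j]; last first.
    case: ifP => [Hij|_]; last by rewrite mul0mx.
    by rewrite (coset_rep_uniq Hij Hii) eqxx in neq_j.
  rewrite -/(t i) Hii /L; have Hg := subsetP sNH _ Ng.
  case: ifP => Hi; rewrite mul_mx_row mulmx0 mul_row_block;
    rewrite !mulmx0 !mul0mx !addr0.
    rewrite rNE // -!repr_mxM //.
    by rewrite mulgKV.
  have Hi' := Hts _ (negbT Hi).
  rewrite add0r rN'E // -!repr_mxM ?(subsetP sNH _ (NJ _ _ Ng Gs)) //.
  by rewrite !mulgA !mulgKV.
Qed.

End IndexTwo.

(** * Generators of the symplectic group *)

Section Generators.

Variables (F : finFieldType) (n : nat).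
Local Notation m := n.+1.
Local Notation gT := {'GL_(n.+1 + n.+1)[F]}.

Lemma similitude_block l (A B C D : 'M[F]_m) :
  similitude l (block_mx A B C D) ->
  [/\ A *m B^T = B *m A^T, A *m D^T = l%:M + B *m C^T
    & C *m D^T = D *m C^T].
Proof.
rewrite similitude_mx /form_mx tr_block_mx !mulmx_block scale_block_mx.
rewrite !mulmx0 !mulmxN !mulmx1 !add0r !addr0 !scaler0 !mulNmx.
case/eqP/eq_block_mx => + + _ +.
rewrite addrC => /subr0_eq AB; rewrite addrC => /(canRL (subrK _)) AD.
rewrite addrC => /subr0_eq CD; split=> //.
by rewrite AD scalemx1.
Qed.

(** After a change of bases A becomes a diagonal idempotent e, and s = 1 - e
    works: if v (e + B s) = 0, multiplying by e gives v e = 0, and so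
    v B = v B e; but B e = e B^T by symmetry, so v B = v e B^T = 0. *)
Lemma exists_sym_unit (A B : 'M[F]_m) :
    A *m B^T = B *m A^T ->
    (forall v : 'rV_m, v *m A = 0 -> v *m B = 0 -> v = 0) ->
  exists2 s : 'M[F]_m, s^T = s & A + B *m s \in unitmx.
Proof.
move=> symAB kerAB; set e : 'M[F]_m := pid_mx (\rank A).
set P := col_ebase A; set Q := row_ebase A.
have uP : P \in unitmx by apply: col_ebase_unit.
have uQ : Q \in unitmx by apply: row_ebase_unit.
have AE : A = P *m e *m Q by rewrite mulmx_ebase.
have eT : e^T = e by apply: tr_pid_mx.
have ee : e *m e = e by apply: pid_mx_id; apply: rank_leq_row.
(* B in the coordinates adapted to A. *)
pose B' := invmx P *m B *m Q^T.
have BE : B = P *m B' *m invmx Q^T.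
  by rewrite /B' !mulmxA mulmxV // mul1mx mulmxK ?unitmx_tr.
have symB' : e *m B'^T = B' *m e.
  have := symAB; rewrite AE BE !trmx_mul eT trmx_inv trmxK.
  rewrite !mulmxA mulmxK // mulmxKV ?unitmx_tr //.
  move/(can_inj (mulmxK _)); rewrite unitmx_tr => /(_ uP).
  by rewrite -!mulmxA => /(can_inj (mulKmx uP)).
(* B' is made opaque, lest mulmxA take its defining product apart. *)
move: B' BE symB' => B' BE symB'.
exists (Q^T *m (1%:M - e) *m Q).
  by rewrite !trmx_mul linearB /= trmx1 eT trmxK mulmxA.
have -> : A + B *m (Q^T *m (1%:M - e) *m Q) =
    P *m (e + B' *m (1%:M - e)) *m Q.
  rewrite [in LHS]AE BE [in RHS]mulmxDr [in RHS]mulmxDl !mulmxA.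
  by rewrite mulmxKV ?unitmx_tr.
rewrite !unitmx_mul uP uQ andbT /= -row_free_unit.
apply: inj_row_free => v; rewrite mulmxDr => v0.
have ve : v *m e = 0.
  have := congr1 (mulmx^~ e) v0; rewrite mul0mx mulmxDl -!mulmxA ee.
  by rewrite mulmxBl mul1mx ee subrr !mulmx0 addr0.
have vB : v *m B' = 0.
  move: v0; rewrite ve add0r mulmxBr mulmx1 mulmxBr -symB'.
  by rewrite mulmxA ve mul0mx subr0.
suff: v *m invmx P = 0.
  by move/(congr1 (mulmx^~ P)); rewrite mulmxKV // mul0mx.
apply: kerAB; first by rewrite AE !mulmxA mulmxKV // ve mul0mx.
by rewrite BE !mulmxA mulmxKV // vB mul0mx.
Qed.

Lemma Sp_subset (K : {group gT}) :
    (forall b g, b^T = b -> gmx g = nX_mx b -> g \in K) ->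
    (forall a g, a \in unitmx -> gmx g = mX_mx a -> g \in K) ->
    (forall g, gmx g = omega_mx F m -> g \in K) ->
  Sp F n \subset K.
Proof.
move=> Kn Km Kw; apply/subsetP => g0 Sg0.
have [w Sw wE] := exists_Sp (similitude_omega F m).
have Kww := Kw _ wE.
(* Lower unipotents are the conjugates of the n(b) by omega. *)
have Kl c : c^T = c ->
    exists2 l, l \in K :&: Sp F n & gmx l = block_mx 1%:M 0 c 1%:M.
  move=> symc; have symNc : (- c)^T = - c by rewrite linearN /= symc.
  have [u Su uE] := exists_Sp (similitude_nX symNc).
  exists (u ^ w)%g; first by rewrite inE !groupJ // (Kn _ _ symNc uE).
  have uw := similitude_unit (oner_neq0 F) (similitude_omega F m).
  apply: (can_inj (mulKmx uw)).
  rewrite -{1}wE -gmxM -conjgC gmxM uE wE /omega_mx /nX_mx !mulmx_block.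
  by rewrite !(mulmx0, mul0mx, mulmx1, mul1mx, addr0, add0r, mulNmx).
(* Open cell: m(A^-1) g n(- A^-1 B) is block lower triangular with identity
   upper left block, hence a lower unipotent because it is symplectic. *)
have Ku A B D0 D g : g \in Sp F n -> A \in unitmx ->
    gmx g = block_mx A B D0 D -> g \in K.
  move=> Sg uA gE; have sg : similitude 1 (block_mx A B D0 D).
    by rewrite -gE; rewrite inE in Sg.
  have [AB _ _] := similitude_block sg.
  pose b := - (invmx A *m B).
  have symb : b^T = b.
    rewrite /b linearN /= trmx_mul trmx_inv; congr (- _).
    apply: (can_inj (mulKmx uA)); rewrite mulmxA AB mulmxK ?unitmx_tr //.
    by rewrite mulKVmx.
  have [u Su uE] := exists_Sp (similitude_nX symb).
  have uA' : invmx A \in unitmx by rewrite unitmx_inv.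
  have [t St tE] := exists_Sp (similitude_mX uA').
  rewrite -(groupMr _ (Kn _ _ symb uE)) -(groupMl _ (Km _ _ uA' tE)).
  have Sh : (t * (g * u))%g \in Sp F n by rewrite !groupM.
  set h := (t * _)%g in Sh *.
  have [C' [D' hE]] : exists C' D', gmx h = block_mx 1%:M 0 C' D'.
    rewrite /h !gmxM tE gE uE /mX_mx /nX_mx !mulmx_block.
    rewrite !(mulmx0, mul0mx, mulmx1, mul1mx, addr0, add0r) mulVmx //.
    rewrite /b mulmxN mulKVmx // addNr mulmx0; eexists; eexists; reflexivity.
  have sh : similitude 1 (block_mx 1%:M 0 C' D').
    by rewrite -hE; rewrite inE in Sh.
  have [_] := similitude_block sh; rewrite mul1mx mul0mx addr0.
  move/(congr1 trmx); rewrite trmxK trmx1 => D1.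
  rewrite D1 trmx1 mulmx1 mul1mx in hE * => symC.
  have [|l /setIP[Kl' _] lE] := Kl C'; first by rewrite -symC.
  by have -> : h = l by apply: gmx_inj; rewrite hE.
have [A [B [D0 [D gE]]]] : exists A B D0 D, gmx g0 = block_mx A B D0 D.
  by exists (ulsubmx (gmx g0)), (ursubmx (gmx g0)), (dlsubmx (gmx g0)),
    (drsubmx (gmx g0)); rewrite submxK.
have sg : similitude 1 (block_mx A B D0 D) by rewrite -gE; rewrite inE in Sg0.
have [AB _ _] := similitude_block sg.
have [|s syms uABs] := exists_sym_unit AB.
  move=> v vA vB; have ug := similitude_unit (oner_neq0 F) sg.
  have: row_mx v 0 *m block_mx A B D0 D = 0.
    by rewrite mul_row_block vA vB !mul0mx !addr0 row_mx0.
  move/(congr1 (mulmx^~ (invmx (block_mx A B D0 D)))).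
  by rewrite mul0mx mulmxK // -row_mx0 => /eq_row_mx[].
have [l /setIP[Kl' Sl] lE] := Kl s syms.
rewrite -(groupMr _ Kl'); have Sgl := groupM Sg0 Sl.
apply: (Ku (A + B *m s) B (D0 + D *m s) D _ Sgl uABs).
rewrite gmxM gE lE mulmx_block.
by rewrite !(mulmx0, mulmx1, addr0, add0r).
Qed.

End Generators.

(** * Non-squares and quadratic Gauss sums *)

(** A field of characteristic two has order a power of 2, never 3 modulo 4. *)
Lemma finField_mod4_two_neq0 (F : finFieldType) :
  #|F| = 3 %[mod 4] -> (2%:R : F) != 0.
Proof.
move=> F3; apply/negP => F2.
have ch2 : 2%N \in [pchar F] by rewrite inE /= F2.
have /abelem_pgroup := fin_ring_pchar_abelem ch2.
rewrite /pgroup cardsT => /p_natP[[|[|k]] cF]; rewrite cF // in F3.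
by rewrite -{1}[k.+2]addn2 expnD modnMl in F3.
Qed.

Section Nonsquares.

Variable F : finFieldType.

Lemma squaresP (u : {unit F}) :
  reflect (exists t : F, val u = t ^+ 2) (u \in squares F).
Proof.
apply: (iffP imsetP) => [[t _ ->]|[t ut]]; first by exists (val t).
have t0 : t \is a GRing.unit.
  by rewrite -(unitrX_pos _ (isT : 0 < 2)%N) -ut (valP u).
by exists (FinRing.unit _ t0) => //; apply: val_inj.
Qed.

(** Non-squares are the odd powers of a generator of the cyclic group F^*. *)
Lemma nonsquareM (a b : {unit F}) :
  a \notin squares F -> b \notin squares F -> (a * b)%g \in squares F.
Proof.
have /cyclicP[g gE] := field_unit_group_cyclic [set: {unit F}].
have gX (u : {unit F}) : exists i, u = (g ^+ i)%g.
  by apply/cycleP; rewrite -gE inE.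
have even_sq k : ~~ odd k -> (g ^+ k)%g \in squares F.
  move=> /negbTE ek; apply/imsetP; exists (g ^+ k./2)%g => //.
  by rewrite -expgM muln2 -[LHS]/(g ^+ k)%g -{1}(odd_double_half k) ek.
have [[i ->] [j ->]] := (gX a, gX b) => Ni Nj.
rewrite -expgD even_sq // oddD (negbNE (contra (@even_sq i) Ni)).
by rewrite (negbNE (contra (@even_sq j) Nj)).
Qed.

Lemma nonsquareX (a : {unit F}) k :
  a \notin squares F -> ((a ^+ k)%g \in squares F) = ~~ odd k.
Proof.
move=> Na; elim: k => [|k IHk]; first by rewrite expg0 group1.
rewrite expgS /=; case: (boolP (odd k)) IHk => /= _ IHk.
  by rewrite nonsquareM ?IHk.
by rewrite groupMr ?IHk ?(negbTE Na).
Qed.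

Lemma legendre_nonsquareX (C : numClosedFieldType) (a : {unit F}) k :
  a \notin squares F -> legendre C (val a ^+ k) = (-1) ^+ k.
Proof.
move=> Na; have aE : val a ^+ k = val (a ^+ k)%g by rewrite FinRing.val_unitX.
rewrite /legendre expf_eq0 -[val a == 0]negbK -unitfE (valP a) andbF.
rewrite -signr_odd -[odd k]negbK -(nonsquareX k Na) aE.
case: (squaresP (a ^+ k)%g) => [[t ->]|Nsq].
  by rewrite ifT //; apply/existsP; exists t.
by rewrite ifN //; apply/existsP => -[t /eqP ?]; apply: Nsq; exists t.
Qed.

Hypothesis F2 : (2%:R : F) != 0.

Lemma card_sqr_roots (s : F) : s != 0 -> #|[set x | x ^+ 2 == s ^+ 2]| = 2%N.
Proof.
move=> s0; have -> : [set x | x ^+ 2 == s ^+ 2] = [set s; - s].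
  by apply/setP => x; rewrite !inE eqf_sqr.
by rewrite cards2 -addr_eq0 -mulr2n -mulr_natl mulf_neq0.
Qed.

(** Exactly one of t and t / a is a square when t is nonzero, and 0 is counted
    once on each side. *)
Lemma card_sqr_roots_twist (a : {unit F}) (t : F) : a \notin squares F ->
  (#|[set x | (x ^+ 2)%R == t]| + #|[set x | (val a * x ^+ 2)%R == t]|)%N = 2%N.
Proof.
move=> Na; have a0 : val a != 0 by rewrite -unitfE (valP a).
have [->|t0] := eqVneq t 0.
  have -> : [set x | val a * x ^+ 2 == 0] = [set x : F | x == 0].
    by apply/setP => x; rewrite !inE mulf_eq0 (negbTE a0) sqrf_eq0.
  have -> : [set x : F | x ^+ 2 == 0] = [set x | x == 0].
    by apply/setP => x; rewrite !inE sqrf_eq0.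
  rewrite (_ : [set x : F | x == 0] = [set 0]) ?cards1 //.
  by apply/setP => x; rewrite !inE.
have ut : t \is a GRing.unit by rewrite unitfE.
pose u : {unit F} := FinRing.unit _ ut.
have [/imsetP[s _ us]|Nu] := boolP (u \in squares F).
  have s0 : val s != 0 by rewrite -unitfE (valP s).
  have tE : t = val s ^+ 2 by rewrite -[t]/(val u) us.
  rewrite tE card_sqr_roots // (_ : [set x | _] = set0) ?cards0 //.
  apply/setP => x; rewrite !inE; apply: contraNF Na => /eqP axs.
  apply/squaresP; exists (val s / x).
  have x0 : x ^+ 2 != 0.
    by apply: contraTneq s0 => x0; rewrite -sqrf_eq0 -axs x0 mulr0 negbK.
  by rewrite exprMn exprVn -axs mulfK.
have /imsetP[s _ us] : (a^-1 * u)%g \in squares F by rewrite nonsquareM ?groupV.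
have s0 : val s != 0 by rewrite -unitfE (valP s).
have tE : t = val a * val s ^+ 2.
  by rewrite -[t]/(val u) -(mulKVg a u) us.
rewrite (_ : [set x | _] = set0) ?cards0.
  rewrite add0n -[RHS](card_sqr_roots s0); apply: eq_card => x.
  by rewrite !inE tE (inj_eq (mulfI a0)).
apply/setP => x; rewrite !inE; apply: contraNF Nu => /eqP xt.
by apply/squaresP; exists x.
Qed.

Lemma sum_sqr_twist (C : zmodType) (f : F -> C) (a : {unit F}) :
  a \notin squares F ->
  \sum_x f (x ^+ 2) + \sum_x f (val a * x ^+ 2) = (\sum_t f t) *+ 2.
Proof.
move=> Na; rewrite (partition_big (fun x : F => x ^+ 2) xpredT) //=.
rewrite [X in _ + X](partition_big (fun x : F => val a * x ^+ 2) xpredT) //=.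
rewrite -big_split -sumrMnl; apply: eq_bigr => t _ /=.
rewrite -[X in _ *+ X](card_sqr_roots_twist t Na) mulrnDr -!sumr_const.
by congr (_ + _); apply: eq_big => [x|x /eqP ->]; rewrite ?inE.
Qed.

Lemma sum_nontrivial_character (C : numClosedFieldType) (psi : F -> C) :
  nontrivial_character psi -> \sum_t psi t = 0.
Proof.
case=> _ psiD [x psix]; apply: contraNeq psix => S0.
apply/eqP; apply: (mulIf S0); rewrite mul1r mulr_sumr.
rewrite [RHS](reindex_inj (addrI x)).
by apply: eq_bigr => t _; rewrite psiD.
Qed.

(** gamma(psi) + gamma(psi^a) is twice the sum of psi over F, which vanishes. *)
Lemma gamma_twist (C : numClosedFieldType) (psi : F -> C) (a : {unit F}) :
    nontrivial_character psi -> a \notin squares F ->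
  gamma (twist psi (val a)) = - gamma psi.
Proof.
move=> psi_char Na; apply/eqP; rewrite -addr_eq0 addrC /gamma /twist.
under [X in _ + X]eq_bigr do rewrite mulrA.
rewrite (sum_sqr_twist (fun t => psi (t / 2%:R)) Na).
rewrite -(reindex_inj (mulIf (invr_neq0 F2)) (P := xpredT) (F := psi)).
by rewrite sum_nontrivial_character // mul0rn.
Qed.

End Nonsquares.

(** * The similitude factor and the index of F^* Sp(W) *)

Section SimilitudeFactor.

Variables (F : finFieldType) (n : nat).
Local Notation gT := {'GL_(n.+1 + n.+1)[F]}.
Implicit Types x y : gT.

Lemma similitude_inj l l' x :
  similitude l (gmx x) -> similitude l' (gmx x) -> l = l'.
Proof.
rewrite !similitude_mx => /eqP-> /eqP eq_l.
have: l%:M = l'%:M :> 'M[F]_(n.+1 + n.+1).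
  apply: (can_inj (mulmxK (form_mx_unit F n.+1))).
  by rewrite !mul_scalar_mx.
by move/matrixP/(_ 0 0); rewrite !mxE eqxx !mulr1n.
Qed.

Lemma similitudeV l x : l != 0 ->
  similitude l (gmx x) -> similitude l^-1 (gmx x^-1%g).
Proof.
move=> l0 /similitudeP sx; apply/similitudeP => w w'.
apply: (mulfI l0); rewrite mulVKf // -sx -!mulmxA -gmxM mulVg gmx1.
by rewrite !mulmx1.
Qed.

Lemma GSpP x :
  reflect (exists u : {unit F}, similitude (val u) (gmx x)) (x \in GSp F n).
Proof.
rewrite inE; apply: (iffP existsP) => [[l /andP[l0 sx]]|[u sx]].
  by rewrite -unitfE in l0; exists (FinRing.unit _ l0).
by exists (val u); rewrite sx andbT -unitfE (valP u).
Qed.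

Lemma mem_FSp (u : {unit F}) x :
  similitude (val u) (gmx x) -> (x \in FSp F n) = (u \in squares F).
Proof.
move=> sx; rewrite inE; apply/existsP/imsetP.
  case=> t /existsP[h /andP[]]; rewrite inE => sh /eqP xE; exists t => //.
  apply/val_inj/(similitude_inj sx).
  by rewrite xE; apply: similitudeZ.
case=> t _ uE; exists t; have tu := valP t.
have [|h Sh hE] := @exists_Sp F n ((val t)^-1 *: gmx x).
  have -> : 1 = (val t)^-1 ^+ 2 * val u.
    by rewrite uE /= -expr2 exprVn mulVr ?unitrX.
  rewrite -[X in _ *: X]mul1mx scalemxAl; apply: similitudeM sx.
  exact/similitudeZ/similitude1.
by apply/existsP; exists h; rewrite Sh hE scalerA mulrV // scale1r eqxx.
Qed.

Lemma GSp_norm_Sp : GSp F n \subset 'N(Sp F n).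
Proof.
apply/subsetP => x /GSpP[u sx]; rewrite inE.
apply/subsetP => _ /imsetP[g Sg ->].
have u0 : val u != 0 by rewrite -unitfE (valP u).
rewrite !inE in Sg *; rewrite !gmxM -(mulVf u0).
apply: similitudeM; first exact: similitudeV.
by rewrite -[val u]mul1r; apply: similitudeM.
Qed.

Lemma index_FSp x : x \in GSp F n :\: FSp F n -> #|GSp F n : FSp F n| = 2%N.
Proof.
case/setDP => Gx Hx; rewrite -[LHS]/#|rcosets (FSp F n) (GSp F n)|.
have -> : rcosets (FSp F n) (GSp F n) =
    [set (FSp F n : {set gT}); FSp F n :* x].
  apply/setP => A; rewrite !inE; apply/rcosetsP/orP; last first.
    by case=> /eqP->; [exists 1%g; rewrite ?group1 // rcoset1 | exists x].
  case=> y Gy ->; have [Hy|Ny] := boolP (y \in FSp F n).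
    by left; rewrite rcoset_id.
  right; apply/eqP/rcoset_eqP; rewrite mem_rcoset.
  have [[u sx] [v sy]] := (GSpP _ Gx, GSpP _ Gy).
  have u0 : val u != 0 by rewrite -unitfE (valP u).
  rewrite (@mem_FSp (v * u^-1)%g).
    by rewrite nonsquareM ?groupV // -?(mem_FSp sx) -?(mem_FSp sy).
  by rewrite gmxM; apply: (similitudeM sy); apply: similitudeV.
rewrite cards2 (_ : _ != _) //; apply: contra Hx => /eqP->; exact: rcoset_refl.
Qed.

End SimilitudeFactor.

(** * Conjugating the Weil representation by a similitude *)

Section WeilTwist.

Variables (C : numClosedFieldType) (F : finFieldType) (n : nat).
Local Notation X := 'rV[F]_n.+1.
Local Notation gT := {'GL_(n.+1 + n.+1)[F]}.
Local Notation repr_CX := (mx_representation C (Sp F n) #|{: X}|).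

(** Every column is a fun_col, so formulas on functions determine an operator. *)
Lemma fun_col_inj_mx (M N : 'M[C]_#|{: X}|) :
  (forall f : X -> C, M *m fun_col f = N *m fun_col f) -> M = N.
Proof.
move=> eqMN; apply/matrixP => i j.
pose f (y : X) : C := (y == enum_val j)%:R.
have dE : fun_col f = delta_mx j 0.
  by apply/colP => k; rewrite !mxE /f (inj_eq enum_val_inj) eqxx andbT.
by have /colP/(_ i) := eqMN f; rewrite dE -!colE !mxE.
Qed.

Lemma eq_fun_col (f g : X -> C) : f =1 g -> fun_col f = fun_col g.
Proof. by move=> eq_fg; apply/colP => i; rewrite !mxE. Qed.

Lemma form_inX_omega (x y : X) :
  Defs.form (inX x) (inX y *m omega_mx F n.+1) = - (x *m y^T) 0 0.
Proof.
rewrite /inX /omega_mx mul_row_block !mul0mx !mulmx0 !addr0 formE.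
rewrite mulmxN mulmx1 trmx0 mulmx0 [X in _ - X]mxE subr0.
by rewrite linearN mulmxN mxE.
Qed.

Lemma form_inX_inXs (x y : X) : Defs.form (inX x) (inXs y) = (x *m y^T) 0 0.
Proof. by rewrite formE trmx0 mulmx0 [X in _ - X]mxE subr0. Qed.

Definition dilation_mx (a : F) : 'M[F]_(n.+1 + n.+1) := block_mx a%:M 0 0 1%:M.

Lemma similitude_dilation a : similitude a (dilation_mx a).
Proof.
rewrite similitude_mx /form_mx /dilation_mx tr_block_mx !mulmx_block.
rewrite !(mulmx0, mul0mx, mulmx1, mul1mx, addr0, add0r, trmx0, trmx1).
by rewrite tr_scalar_mx mulNmx mul1mx scale_block_mx !scaler0 scalerN scalemx1.
Qed.

(** The operators are compared on the generators n(b), m(A) and omega; on omega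
    the sign legendre (a ^ m) cancels the one that separates gamma(psi^a) ^- m
    from gamma(psi) ^- m. *)
Lemma weil_repr_twist (psi : F -> C) (a : {unit F}) (pi pia : repr_CX) s :
    (2%:R : F) != 0 -> nontrivial_character psi -> a \notin squares F ->
    weil_repr psi pi -> weil_repr (twist psi (val a)) pia ->
    gmx s = dilation_mx (val a) ->
  {in Sp F n, forall g, pia g = pi (s * g * s^-1)%g}.
Proof.
move=> F2 psi_char Na [piN piM piW] [piaN piaM piaW] sE.
have ua := valP a; have a0 : val a != 0 by rewrite -unitfE.
have Gs : s \in GSp F n by apply/GSpP; exists a; rewrite sE similitude_dilation.
have SpJ g : (s * g * s^-1)%g \in Sp F n = (g \in Sp F n).
  rewrite -(memJ_norm g (subsetP (GSp_norm_Sp F n) _ (groupVr Gs))).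
  by rewrite conjgE invgK mulgA.
pose K := [set g in Sp F n | pia g == pi (s * g * s^-1)%g].
have gK : group_set K.
  apply/group_setP; split=> [|g h].
    by apply/setIdP; rewrite group1 mulg1 mulgV !repr_mx1.
  case/setIdP=> Sg /eqP gE /setIdP[Sh /eqP hE].
  apply/setIdP; rewrite groupM //= repr_mxM // gE hE -repr_mxM ?SpJ //.
  by rewrite !mulgA mulgKV.
have conjE g h : gmx h *m dilation_mx (val a) = dilation_mx (val a) *m gmx g ->
    h = (s * g * s^-1)%g.
  by rewrite -sE -!gmxM => /gmx_inj <-; rewrite mulgK.
have inK g h : g \in Sp F n ->
    gmx h *m dilation_mx (val a) = dilation_mx (val a) *m gmx g ->
    pia g = pi h -> g \in K.
  by move=> Sg /conjE -> E; apply/setIdP; rewrite E.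
suff sub : Sp F n \subset Group gK.
  by move=> g /(subsetP sub)/setIdP[_ /eqP].
apply: Sp_subset => [b g symb gE|A g uA gE|g gE].
- have symab : (val a *: b)^T = val a *: b by rewrite linearZ /= symb.
  have Sg : g \in Sp F n by rewrite inE gE similitude_nX.
  have [h Sh hE] := exists_Sp (similitude_nX symab).
  apply: (inK _ h) => //.
    rewrite hE gE /nX_mx /dilation_mx !mulmx_block.
    by rewrite !(mulmx0, mul0mx, mulmx1, mul1mx, addr0, add0r) mul_scalar_mx.
  apply: fun_col_inj_mx => f; rewrite (piaN b) // (piN _ h symab hE).
  apply: eq_fun_col => y; rewrite /twist !form_inX_inXs; congr (psi _ * _).
  by rewrite -scalemxAr linearZ /= -scalemxAr [in RHS]mxE mulrCA.
- have Sg : g \in Sp F n by rewrite inE gE similitude_mX.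
  apply: (inK _ g) => //.
    rewrite gE /mX_mx /dilation_mx !mulmx_block.
    by rewrite !(mulmx0, mul0mx, mulmx1, mul1mx, addr0, add0r) scalar_mxC.
  by apply: fun_col_inj_mx => f; rewrite (piaM A) // (piM A).
have Sg : g \in Sp F n by rewrite inE gE similitude_omega.
have uaM : (val a)%:M \in @unitmx F n.+1.
  by rewrite -scalemx1 unitmxZ // unitmx1.
have [h Sh hE] := exists_Sp (similitude_mX uaM).
(* d omega d^-1 = m(a) omega. *)
apply: (inK _ (h * g)%g) => //.
  rewrite gmxM hE gE /mX_mx /omega_mx /dilation_mx !mulmx_block.
  rewrite !(mulmx0, mul0mx, mulmx1, mul1mx, addr0, add0r, mulmxN, mulNmx).
  by rewrite tr_scalar_mx mulVmx.
apply: fun_col_inj_mx => f; rewrite repr_mxM // -mulmxA piaW // piW //.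
rewrite (piM _ h uaM hE); apply: eq_fun_col => y.
rewrite det_scalar legendre_nonsquareX // gamma_twist //.
rewrite [(- gamma psi) ^+ _]exprNn invfM mulrA.
rewrite -exprVn invrN invr1; congr (_ * _).
apply: eq_bigr => x _; rewrite /twist !form_inX_omega mul_mx_scalar.
by rewrite linearZ /= -scalemxAr [in RHS]mxE mulrN.
Qed.

End WeilTwist.

(** * The restriction of rho_psi to Sp(W) *)

Theorem lemma2p3 (C : numClosedFieldType) (F : finFieldType) (n : nat)
    (q_mod4 : #|F| = 3 %[mod 4])
    (psi : F -> C) (psi_char : nontrivial_character psi)
    (varpi : {unit F}) (varpi_gen : generator (squares F) varpi)
    (tau : {morphism squares F >-> {unit F}})
    (tau_varpi : tau (varpi ^+ 2)%g = (varpi^-1)%g)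
    (pi : mx_representation C (Sp F n) #|{: 'rV[F]_n.+1}|)
    (pi_weil : weil_repr psi pi)
    (piE : mx_representation C (FSp F n) #|{: 'rV[F]_n.+1}|)
    (piE_ext : weil_extension tau pi piE)
    (a : {unit F}) (a_nonsquare : a \notin squares F)
    (pia : mx_representation C (Sp F n) #|{: 'rV[F]_n.+1}|)
    (pia_weil : weil_repr (twist psi (val a)) pia) :
  mx_rsim (subg_repr (ind_repr (FSp_sub_GSp F n) piE) (Sp_sub_GSp F n))
          (dadd_grepr (Representation pi) (Representation pia)).
Proof.
have F2 := finField_mod4_two_neq0 q_mod4.
have sim_a := similitude_dilation n (val a).
have a0 : val a != 0 by rewrite -unitfE (valP a).
have [s sE] := exists_gmx (similitude_unit a0 sim_a); rewrite -sE in sim_a.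
have GHs : s \in GSp F n :\: FSp F n.
  by apply/setDP; split; [apply/GSpP; exists a | rewrite (mem_FSp sim_a)].
have [/setDP[Gs _] [piEE _]] := (GHs, piE_ext).
apply: (@res_ind_index2 _ _ _ _ _ _ (FSp_sub_GSp F n) (Sp_sub_GSp F n)
  (Sp_sub_FSp F n) (index_FSp GHs) piE pi pia s (GSp_norm_Sp F n) GHs).
  by move=> g Sg; rewrite piEE.
have twistE := weil_repr_twist F2 psi_char a_nonsquare pi_weil pia_weil sE.
move=> g Sg; rewrite twistE // piEE //.
have := memJ_norm g (subsetP (GSp_norm_Sp F n) _ (groupVr Gs)).
by rewrite conjgE invgK mulgA Sg.
Qed.
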